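(* Let $\mathcal{C}^1 = \mathcal{C}(I^1_1,g^1), \ldots, \mathcal{C}^n = \mathcal{C}(I^n_1,g^n)$ be Cantor sets with density ratios equal to $x_1, \ldots, x_n$ respectively, such that $$\sum_{i=1}^n \frac{x_i}{x_i+1} \ge 1$$ and for all $j,k$, $$|I^j_1| \ge \frac{x_j}{x_j+1}\cdot\frac{x_k+1}{2x_k+1}\,|I^k_1|.$$ Then $\sum_{i=1}^n I^i_1 = \{\sum_{i=1}^n y_i : y_i \in \mathcal{C}^i\}$.
   Context: For an interval $I$ with endpoints $a<b$ write $|I| = b-a$. A Cantor set $\mathcal{C}(I_1, g)$ is given by a closed interval $I_1$ of positive length and a gap function $g$: recursively, for every constructed interval $I_i$, $g(I_i)$ is an open subinterval of $I_i$ with $I_i = I_{2i} \cup g(I_i) \cup I_{2i+1}$ disjointly, where $I_{2i}, I_{2i+1}$ are closed intervals of positive length to the left and right of the gap; the Cantor set is $I_1 \setminus \bigcup_i g(I_i)$. Its density ratio is $\inf_i \min(|I_{2i}|,|I_{2i+1}|)/|g(I_i)|$. Sums of intervals are pointwise: $[a_l,a_r]+[b_l,b_r]=[a_l+b_l,a_r+b_r]$. *)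

(* Defs.v *)
From Corelib Require Import BinNums.
From mathcomp Require Import all_boot all_order all_algebra.
From mathcomp Require Import all_classical all_reals.
Set Implicit Arguments.
Unset Strict Implicit.
Unset Printing Implicit Defensive.

Import Order.TTheory GRing.Theory Num.Theory.
Local Open Scope classical_set_scope.
Local Open Scope ring_scope.

Section CantorSets.
Variable R : realType.

(* An interval is given by its pair of endpoints; whether it is read as closed
   (the bridges I_i) or open (the gaps) is decided by clitv and opitv. *)
Implicit Types I J : R * R.

Definition clitv J : set R := [set` `[J.1, J.2]].
Definition opitv J : set R := [set` `]J.1, J.2[].
Definition itvlen J : R := J.2 - J.1.

(* A gap function sends a closed interval to its gap. It is total here, but
   only its values on the constructed intervals matter. *)
Implicit Type g : R * R -> R * R.

(* The binary index i >= 1 is a positive: xO i is 2i and xI i is 2i + 1. *)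
Fixpoint bridge I1 g (i : positive) : R * R :=
  match i with
  | xH => I1
  | xO i' => ((bridge I1 g i').1, (g (bridge I1 g i')).1)
  | xI i' => ((g (bridge I1 g i')).2, (bridge I1 g i').2)
  end.

Definition gap I1 g (i : positive) : R * R := g (bridge I1 g i).

(* For I_i = [a, b] and g(I_i) = ]c, d[ the condition is a < c < d < b: then
   [a, b] is the disjoint union of [a, c], ]c, d[ and [d, b], where the gap is
   nonempty and both closed pieces have positive length. *)
Definition is_cantor_data I1 g : Prop :=
  I1.1 < I1.2 /\
  forall i : positive,
    [/\ (bridge I1 g i).1 < (gap I1 g i).1,
        (gap I1 g i).1 < (gap I1 g i).2
      & (gap I1 g i).2 < (bridge I1 g i).2].

Definition cantor_set I1 g : set R :=
  clitv I1 `\` \bigcup_(i in [set: positive]) opitv (gap I1 g i).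

(* For Cantor data the ratios form a nonempty set of positive reals, so inf is
   a genuine infimum. *)
Definition density_ratio I1 g : R :=
  inf [set Num.min (itvlen (bridge I1 g (xO i))) (itvlen (bridge I1 g (xI i)))
             / itvlen (gap I1 g i) | i in [set: positive]].

End CantorSets.

(* Main.v *)
Require Import Defs.
From Stdlib Require Import PArith.
From mathcomp Require Import all_boot all_order all_algebra.
From mathcomp Require Import all_classical all_reals.
From mathcomp Require Import topology normedtype ring lra.
Import Order.TTheory GRing.Theory Num.Theory.
Import numFieldNormedType.Exports.
Local Open Scope classical_set_scope.
Local Open Scope ring_scope.

(** Any two gaps of a Cantor set of density ratio [x] are at distance at least
    [x] times the length of the shorter one, so the gaps can be removed in any
    order that is decreasing in length without losing the bound [x] on the
    ratio of bridge to gap. Remove finitely many gaps from all the Cantor sets,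
    always taking the one, in the [k]-th set say, for which
    [M = (x k + 1) * |gap|] is largest. Along the way every current interval
    [J j] keeps length at least [x j / (x j + 1) * M]: this is the length
    hypothesis at the start, because [(2 * x k + 1) * |gap| <= |I1 k|], and it
    is preserved since a bridge next to the removed gap has length at least
    [x k * |gap| = x k / (x k + 1) * M] while [M] decreases. As the numbers
    [x j / (x j + 1)] add up to at least [1], the intervals other than [J k]
    have total length at least [|gap|], so that [s] remains in the sum of the
    intervals after one of the two bridges is chosen. Compactness then deals
    with all the gaps at once. *)

(** * The prefix order on the binary expansions of indices *)

Inductive descendant (q : positive) : positive -> Prop :=
| descendant_refl : descendant q q
| descendant_xO p : descendant q p -> descendant q (xO p)
| descendant_xI p : descendant q p -> descendant q (xI p).

Lemma descendant1 p : descendant xH p.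
Proof. by elim: p => [p IH|p IH|]; constructor. Qed.

Lemma descendant_child {q p} : descendant q p ->
  [\/ p = q, descendant (xO q) p | descendant (xI q) p].
Proof.
elim=> [|p' _ IH|p' _ IH]; first by constructor 1.
- case: IH => [->|?|?]; [constructor 2|constructor 2|constructor 3];
  by constructor.
- case: IH => [->|?|?]; [constructor 3|constructor 2|constructor 3];
  by constructor.
Qed.

(** In the third case [r] is the longest common prefix, whose gap will lie between the bridges of
    [p] and [q]. *)
Lemma descendant_dichotomy p q :
  [\/ descendant p q, descendant q p
    | exists r, (descendant (xO r) p /\ descendant (xI r) q) \/
                (descendant (xO r) q /\ descendant (xI r) p)].
Proof.
have refl := descendant_refl.
elim: p => [p IH|p IH|]; last by constructor 1; exact: descendant1.
- case: IH => [pq|qp|[r [[? ?]|[? ?]]]].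
  + case: (descendant_child pq) => [->|?|?].
    * by constructor 2; constructor.
    * by constructor 3; exists p; right.
    * by constructor 1.
  + by constructor 2; constructor.
  + by constructor 3; exists r; left; split=> //; constructor.
  + by constructor 3; exists r; right; split=> //; constructor.
- case: IH => [pq|qp|[r [[? ?]|[? ?]]]].
  + case: (descendant_child pq) => [->|?|?].
    * by constructor 2; constructor.
    * by constructor 1.
    * by constructor 3; exists p; left.
  + by constructor 2; constructor.
  + by constructor 3; exists r; left; split=> //; constructor.
  + by constructor 3; exists r; right; split=> //; constructor.
Qed.

(** * Gaps of a single Cantor set *)

Section Gaps.
Variables (R : realType) (I1 : R * R) (g : R * R -> R * R).
Hypothesis cantorI : is_cantor_data I1 g.

Local Notation br := (bridge I1 g).
Local Notation gp := (gap I1 g).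
Local Notation x := (density_ratio I1 g).

Lemma bridge_descendant q p : descendant q p ->
  (br q).1 <= (br p).1 /\ (br p).2 <= (br q).2.
Proof.
elim=> [//|p' _ [l r]|p' _ [l r]] /=; have := cantorI.2 p';
  rewrite /gap => -[]; lra.
Qed.

Lemma ratio_ge0 i :
  0 <= Num.min (itvlen (br (xO i))) (itvlen (br (xI i))) / itvlen (gp i).
Proof.
have [] := cantorI.2 i; rewrite /itvlen /= -/(gap _ _ _) => ? ? ?.
by rewrite divr_ge0 ?le_min ?subr_ge0 ?ltW.
Qed.

Lemma density_ratio_ge0 : 0 <= x.
Proof.
apply: lb_le_inf; first by eexists; exists xH.
by move=> _ [i _ <-]; exact: ratio_ge0.
Qed.

Lemma density_ratioP p :
  (br p).1 + x * itvlen (gp p) <= (gp p).1 /\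
  (gp p).2 + x * itvlen (gp p) <= (br p).2.
Proof.
have [? lt_gap ?] := cantorI.2 p.
have lex : x <= Num.min (itvlen (br (xO p))) (itvlen (br (xI p))) / itvlen (gp p).
  apply: ge_inf; last by exists p.
  by exists 0 => _ [i _ <-]; exact: ratio_ge0.
have gap_gt0 : 0 < itvlen (gp p) by rewrite subr_gt0.
move: lex; rewrite ler_pdivlMr// le_min => /andP[].
rewrite /= {2 4}/itvlen /= -/(gap _ _ _); lra.
Qed.

Lemma gap_sub1 p :
  I1.1 + x * itvlen (gp p) <= (gp p).1 /\
  (gp p).2 + x * itvlen (gp p) <= I1.2.
Proof.
have [/= ? ?] := bridge_descendant _ _ (descendant1 p).
have := density_ratioP p; lra.
Qed.

Lemma itvlen_gap p : (2 * x + 1) * itvlen (gp p) <= itvlen I1.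
Proof.
have [] := gap_sub1 p.
set w := x * _; have -> : (2 * x + 1) * itvlen (gp p) = w + itvlen (gp p) + w.
  by rewrite /w; ring.
rewrite /itvlen; lra.
Qed.

(** If [q] is a proper descendant of [p], the gap of [q] keeps distance [x * itvlen (gp q)] from the
    ends of its own bridge, and that bridge lies on one side of the gap of [p]. If neither index
    descends from the other, the two bridges lie on opposite sides of the gap of a common prefix. *)
Lemma gap_separated p q : p <> q ->
  let w := x * Num.min (itvlen (gp p)) (itvlen (gp q)) in
  (gp p).2 + w <= (gp q).1 \/ (gp q).2 + w <= (gp p).1.
Proof.
move=> neq w.
have wp : w <= x * itvlen (gp p).
  by rewrite ler_wpM2l ?density_ratio_ge0// ge_min lexx.
have wq : w <= x * itvlen (gp q).
  by rewrite ler_wpM2l ?density_ratio_ge0// ge_min lexx orbT.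
have := density_ratioP p; have := density_ratioP q.
have [? ? ?] := cantorI.2 p; have [? ? ?] := cantorI.2 q.
have sub := bridge_descendant.
case: (descendant_dichotomy p q) => [pq|qp|[r [[pr qr]|[qr pr]]]].
- case: (descendant_child pq) => [/esym//|/sub|/sub] /=;
    rewrite -/(gap _ _ _) => -[? ?] [? ?] [? ?]; [right|left]; lra.
- case: (descendant_child qp) => [//|/sub|/sub] /=;
    rewrite -/(gap _ _ _) => -[? ?] [? ?] [? ?]; [left|right]; lra.
- move: (sub _ _ pr) (sub _ _ qr) (cantorI.2 r) => /=.
  rewrite -/(gap _ _ _) => -[? ?] [? ?] [? ? ?] [? ?] [? ?]; left; lra.
- move: (sub _ _ pr) (sub _ _ qr) (cantorI.2 r) => /=.
  rewrite -/(gap _ _ _) => -[? ?] [? ?] [? ? ?] [? ?] [? ?]; right; lra.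
Qed.

End Gaps.

(** * Avoiding finitely many gaps *)

Section FinitelyManyGaps.
Variables (R : realFieldType) (n m : nat).
Variables (x : 'I_n -> R) (c d : 'I_n -> 'I_m -> R).

Local Notation w i p := (d i p - c i p).

Hypothesis x_ge0 : forall i, 0 <= x i.
Hypothesis sum_ge1 : 1 <= \sum_(i < n) x i / (x i + 1).
Hypothesis w_gt0 : forall i p, 0 < w i p.
Hypothesis separated : forall i p q, p != q ->
  d i p + x i * Num.min (w i p) (w i q) <= c i q \/
  d i q + x i * Num.min (w i p) (w i q) <= c i p.

(* [A] collects the gaps still to be avoided inside the boxes [[a i, b i]]. *)
Record admissible (A : {set 'I_n * 'I_m}) (a b : 'I_n -> R) : Prop := {
  admissible_in : forall i p, (i, p) \in A ->
    a i + x i * w i p <= c i p /\ d i p + x i * w i p <= b i;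
  admissible_out : forall i p, (i, p) \notin A -> d i p <= a i \/ b i <= c i p;
  admissible_len : forall j k p, (k, p) \in A ->
    x j / (x j + 1) * ((x k + 1) * w k p) <= b j - a j;
  admissible_le : forall i, a i <= b i }.

(** A gap inside the kept piece is no longer than the removed one, so [separated] keeps it at
    distance [x k] times its own length from the new endpoint; the other gaps of the [k]-th set miss
    that piece. The piece has length at least [x k * w k p], which the maximality of [(k, p)] turns
    into the length bound for the remaining gaps. *)
Lemma admissible_shrink A a b a' b' k p : admissible A a b -> (k, p) \in A ->
  (forall i q, (i, q) \in A -> (x i + 1) * w i q <= (x k + 1) * w k p) ->
  (forall i, i != k -> a' i = a i /\ b' i = b i) ->
  (a' k = a k /\ b' k = c k p) \/ (a' k = d k p /\ b' k = b k) ->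
  admissible [set q in A | (q.1 != k) ||
                (a' k <= c q.1 q.2) && (d q.1 q.2 <= b' k)] a' b'.
Proof.
move=> [Ain Aout Alen Ale] kpA kpmax eq_ab ab_k.
have xk := x_ge0 k.
have gap_max q : (k, q) \in A -> w k q <= w k p.
  by move=> /kpmax; rewrite ler_pM2l//; lra.
have xw i q : 0 <= x i * w i q by rewrite mulr_ge0// ltW.
have len_k : x k * w k p <= b' k - a' k.
  by have [? ?] := Ain _ _ kpA; case: ab_k => -[-> ->]; lra.
split=> [i q|i q|j i q|i].
- rewrite inE /= => /andP[iqA]; have [? ?] := Ain _ _ iqA.
  have [eik|ik _] := eqVneq i k; last by have [-> ->] := eq_ab _ ik.
  subst i => /= /andP[leac ledb]; have := xw k q; have := w_gt0 k q.
  have [eqp|qp] := eqVneq q p.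
    by subst q; case: ab_k => -[ea eb]; lra.
  have := separated k q p qp; rewrite (min_idPl (gap_max _ iqA)).
  have := w_gt0 k p.
  by case: ab_k => -[ea eb]; move: leac ledb; rewrite ea eb; lra.
- rewrite inE /= negb_and negb_or negbK => iqA'.
  have [eik|ik] := eqVneq i k; last first.
    have [-> ->] := eq_ab _ ik.
    by move: iqA'; rewrite (negPf ik) orbF => /Aout.
  subst i; have [? ?] := Ain _ _ kpA.
  have := xw k p; have := w_gt0 k p; have := w_gt0 k q => ? ? ?.
  have [iqA|/Aout] := boolP ((k, q) \in A); last first.
    by case: ab_k => -[-> ->] [?|?]; lra.
  have [? ?] := Ain _ _ iqA; have := xw k q => ?; move: iqA'; rewrite iqA.
  rewrite eqxx /= negb_and -!ltNge => out.
  have [eqp|qp] := eqVneq q p.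
    by subst q; case: ab_k => -[-> ->]; lra.
  have := separated k q p qp.
  have : 0 <= x k * Num.min (w k q) (w k p).
    by rewrite mulr_ge0// le_min !ltW.
  by case: ab_k out => -[-> ->] /orP[?|?] ? [?|?]; lra.
- rewrite inE => /andP[iqA _].
  have [ejk|jk] := eqVneq j k; last by have [-> ->] := eq_ab _ jk; apply: Alen.
  subst j; apply: le_trans len_k.
  have -> : x k * w k p = x k / (x k + 1) * ((x k + 1) * w k p).
    by field; lra.
  by rewrite ler_wpM2l ?kpmax// divr_ge0//; lra.
- have [->|ik] := eqVneq i k; last by have [-> ->] := eq_ab _ ik.
  by have := xw k p; lra.
Qed.

(* Removing the gap that maximises [(x k + 1) * w k p] leaves no hole in the
   sum of the boxes, since the other boxes have total length at least
   [(1 - x k / (x k + 1)) * ((x k + 1) * w k p) = w k p]. *)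
Lemma sum_avoiding_gaps A a b s : admissible A a b ->
  \sum_i a i <= s <= \sum_i b i ->
  exists y : 'I_n -> R,
    [/\ forall i, a i <= y i <= b i,
        forall i p, y i <= c i p \/ d i p <= y i & s = \sum_i y i].
Proof.
have [N] := ubnP #|A|; elim: N A a b => // N IH A a b leN adm /andP[les leb].
have [A0|[[k0 p0] kp0A]] := set_0Vmem A.
  have Ale := admissible_le _ _ _ adm.
  (* With no gap left, all coordinates can move from [a i] to [b i] with one common parameter
     [t]. *)
  have [t /andP[t0 t1] st] : exists2 t, 0 <= t <= 1 &
      s = \sum_i (a i + t * (b i - a i)).
    have le_ab : \sum_i a i <= \sum_i b i by apply: ler_sum.
    have [eq_ab|ne_ab] := eqVneq (\sum_i a i) (\sum_i b i).
      exists 0; first by rewrite lexx ler01.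
      under eq_bigr do rewrite mul0r addr0.
      by apply/eqP; rewrite eq_le les eq_ab leb.
    have lt_ab : 0 < \sum_i b i - \sum_i a i by rewrite subr_gt0 lt_neqAle ne_ab.
    exists ((s - \sum_i a i) / (\sum_i b i - \sum_i a i)).
      by rewrite divr_ge0 ?ler_pdivrMr ?mul1r//; lra.
    rewrite big_split /= -mulr_sumr sumrB divfK ?gt_eqF//; ring.
  have t01 i : a i <= a i + t * (b i - a i) <= b i.
    by have := Ale i => ?; apply/andP; split; nra.
  exists (fun i => a i + t * (b i - a i)); split=> // i p.
  have [|?|?] := admissible_out _ _ _ adm i p; first by rewrite A0 inE.
    by right; have := t01 i; lra.
  by left; have := t01 i; lra.
pose F (q : 'I_n * 'I_m) := (x q.1 + 1) * w q.1 q.2.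
have [[k p] kpA' kpmax] := arg_maxP F kp0A.
have {kpA'} kpA : (k, p) \in A := kpA'.
have {}kpmax i q : (i, q) \in A -> (x i + 1) * w i q <= (x k + 1) * w k p.
  by move=> iqA; exact: (kpmax (i, q)).
have xk := x_ge0 k.
have others : w k p <= \sum_(j < n | j != k) (b j - a j).
  apply: le_trans (ler_sum _ (fun j _ => admissible_len _ _ _ adm j k p kpA)).
  rewrite -mulr_suml.
  have wE : w k p = (1 - x k / (x k + 1)) * ((x k + 1) * w k p).
    by field; lra.
  rewrite [leLHS]wE ler_wpM2r ?mulr_ge0 ?(ltW (w_gt0 _ _))//; first lra.
  by move: sum_ge1; rewrite (bigD1 k) //=; lra.
rewrite sumrB in others.
have step a' b' : (forall i, i != k -> a' i = a i /\ b' i = b i) ->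
    (a' k = a k /\ b' k = c k p) \/ (a' k = d k p /\ b' k = b k) ->
    \sum_i a' i <= s <= \sum_i b' i ->
    exists y : 'I_n -> R,
    [/\ forall i, a i <= y i <= b i,
        forall i p, y i <= c i p \/ d i p <= y i & s = \sum_i y i].
  move=> eq_ab ab_k s_ab.
  have adm' := admissible_shrink _ _ _ _ _ _ _ adm kpA kpmax eq_ab ab_k.
  have [|y [yab ycd sy]] := IH _ _ _ _ adm' s_ab.
    (* The gap [(k, p)] itself lies in neither piece, so the count drops. *)
    apply: leq_trans (leN : (#|A| <= N)%N); apply: proper_card.
    apply/properP; split; first by apply/fintype.subsetP => q; rewrite inE => /andP[].
    exists (k, p) => //; rewrite inE /= kpA eqxx /=.
    have := w_gt0 k p; apply: contraTN => /andP[].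
    by case: ab_k => -[-> ->]; lra.
  exists y; split=> // i; have := yab i.
  have [->|ik] := eqVneq i k; last by have [-> ->] := eq_ab _ ik.
  have [? ?] := admissible_in _ _ _ adm _ _ kpA.
  have : 0 <= x k * w k p by rewrite mulr_ge0// ltW.
  by have := w_gt0 k p; case: ab_k => -[-> ->]; lra.
rewrite (bigD1 k) //= in les; rewrite (bigD1 k) //= in leb.
(* Keep the left piece if its upper sum reaches [s]. Otherwise, by [others], [s] exceeds [d k p]
   plus the left endpoints of the other boxes, and the right piece works. *)
have [sle|sgt] := leP s (c k p + \sum_(i < n | i != k) b i).
- apply: (step a (fun i => if i == k then c k p else b i)).
  + by move=> i /negPf ->.
  + by left; rewrite eqxx.
  + apply/andP; split; rewrite (bigD1 k) //= eqxx.
    by under eq_bigr => i /negPf -> do [].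
- apply: (step (fun i => if i == k then d k p else a i) b).
  + by move=> i /negPf ->.
  + by right; rewrite eqxx.
  + apply/andP; split; rewrite (bigD1 k) //= eqxx.
    under eq_bigr => i /negPf -> do [].
    lra.
Qed.

End FinitelyManyGaps.

(** * Passage to all gaps by compactness *)

Lemma continuous_proj_fun (R : realType) (I : eqType) (i : I) :
  continuous (fun y : {ptws I -> R} => y i).
Proof. exact: (@proj_continuous I (fun _ => R : topologicalType) i). Qed.

Lemma continuous_sum_proj (R : realType) (n : nat) :
  continuous (fun y : {ptws 'I_n -> R} => \sum_i y i).
Proof.
have addc : continuous (fun z : R * R => z.1 + z.2).
  move=> z; exact: (@add_continuous R z).
apply: (@continuous_big R 'I_n +%R 0 xpredT addc
  {ptws 'I_n -> R} _ (fun i y => y i)) => i _.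
exact: continuous_proj_fun.
Qed.

Theorem theorem3p7 (R : realType) (n : nat)
  (I1 : 'I_n -> R * R) (g : 'I_n -> R * R -> R * R) (x : 'I_n -> R)
  (hC : forall i : 'I_n, is_cantor_data (I1 i) (g i))
  (hx : forall i : 'I_n, density_ratio (I1 i) (g i) = x i)
  (hsum : 1 <= \sum_(i < n) x i / (x i + 1))
  (hlen : forall j k : 'I_n,
     x j / (x j + 1) * ((x k + 1) / (2 * x k + 1)) * itvlen (I1 k)
       <= itvlen (I1 j)) :
  clitv (\sum_(i < n) (I1 i).1, \sum_(i < n) (I1 i).2) =
  [set s : R | exists y : 'I_n -> R,
     (forall i : 'I_n, cantor_set (I1 i) (g i) (y i)) /\
     s = \sum_(i < n) y i].
Proof.
have x_ge0 i : 0 <= x i by rewrite -hx; exact: density_ratio_ge0.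
apply/seteqP; split=> [s /=|s [y [yC ->]]]; last first.
  have yI i : (I1 i).1 <= y i <= (I1 i).2.
    by have [+ _] := yC i; rewrite /clitv /= in_itv.
  rewrite /clitv /= in_itv /=; apply/andP.
  by split; apply: ler_sum => i _; have /andP[] := yI i.
rewrite /clitv /= in_itv /= => s_in.
(* The gaps are enumerated from 0, and stage [N] avoids the first [N] of each set. *)
pose gp i p := gap (I1 i) (g i) (Pos.of_succ_nat p).
have finite N : exists y : 'I_n -> R,
    [/\ forall i, (I1 i).1 <= y i <= (I1 i).2,
        forall i (p : 'I_N), y i <= (gp i p).1 \/ (gp i p).2 <= y i
      & s = \sum_i y i].
  apply: (sum_avoiding_gaps R n N x (fun i p => (gp i p).1)
    (fun i p => (gp i p).2) x_ge0 hsum _ _ [set: _]%SET) s_in.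
  - by move=> i p; rewrite subr_gt0; have [] := (hC i).2 (Pos.of_succ_nat p).
  - move=> i p q pq; rewrite -hx; apply: gap_separated => // /SuccNat2Pos.inj.
    by move/val_inj/eqP; rewrite (negPf pq).
  - split=> [i p _|i p|j k p _|i].
    + by rewrite -hx; exact: gap_sub1.
    + by rewrite inE.
    + have xk := x_ge0 k; have xj := x_ge0 j.
      apply: le_trans (hlen j k); rewrite -[leRHS]mulrA.
      rewrite ler_wpM2l ?divr_ge0//; first lra.
      rewrite -mulrA ler_wpM2l//; first lra.
      rewrite mulrC ler_pdivlMr; last lra.
      by rewrite mulrC -hx; exact: itvlen_gap.
    + by have [/ltW] := hC i.
pose T := {ptws 'I_n -> R}.
have [Y Yfin] := choice finite.
pose F := (Y : nat -> T) @ \oo.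
have : compact [set f : T | forall i, [set` `[(I1 i).1, (I1 i).2]] (f i)].
  exact: (@tychonoff 'I_n (fun _ => R : topologicalType)
    (fun i => [set` `[(I1 i).1, (I1 i).2]]) (fun i => @segment_compact R _ _)).
move/(_ F _) => [|y [yI ycl]].
  by exists 0%N => // N _ i /=; rewrite in_itv /=; have [->] := Yfin N.
(* A closed condition that holds at all late stages passes to the cluster point [y]. *)
have limit (U : set T) : closed U -> (\forall N \near \oo, U (Y N)) -> U y.
  by move=> clU UN; apply: clU; move: ycl; rewrite clusterE; apply.
exists y; split; last first.
  symmetry; apply: (limit [set z : T | \sum_i z i = s]).
    apply: (@preimage_closed _ _ _ [set r | r = s]); last exact: closed_eq.
    by move=> z _; exact: continuous_sum_proj.
  by exists 0%N => // N _; have [] := Yfin N.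
move=> i; split; first by have := yI i.
move=> [p _]; rewrite /opitv /= in_itv /= => /andP[gy yg].
have [p' p'E] : exists p', p = Pos.of_succ_nat p'.
  have [p' pE] := Pos2Nat.is_succ p.
  by exists p'; exact/esym/SuccNat2Pos.inv.
(* Avoiding one open gap is a closed condition, in force at every stage [N > p']. *)
have : ([set z : T | z i <= (gp i p').1] `|` [set z : T | (gp i p').2 <= z i]) y.
  apply: limit.
    apply: closedU.
      apply: (@preimage_closed _ _ _ [set r | r <= _]); last exact: closed_le.
      by move=> z _; exact: continuous_proj_fun.
    apply: (@preimage_closed _ _ _ [set r | _ <= r]); last exact: closed_ge.
    by move=> z _; exact: continuous_proj_fun.
  by exists p'.+1 => // N /= ltN; have [_ + _] := Yfin N => /(_ i (Ordinal ltN)).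
by rewrite /gp -p'E => -[] /=; rewrite leNgt ?gy ?yg.
Qed.
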